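(* Let $n\ge 1$, let $\lambda$ be a partition and $i\ge1$ an integer with $\lambda_i+2\le\lambda_{i-1}$ (where $\lambda_0=\infty$). For $a=0,1,2$ let $\mu^a$ be the partition with $\mu^a_j=\lambda_j$ for $j\ne i$ and $\mu^a_i=\lambda_i+a$, and assume $\mu^2\subseteq\delta_{n-1}$. If $\lambda_{n-\lambda_i-1}=\lambda_{n-\lambda_i}$, then $$G_{\mu^0}[X;q]-G_{\mu^1}[X;q]=q\bigl(G_{\mu^1}[X;q]-G_{\mu^2}[X;q]\bigr)$$ and $$L(n,\mu^0)-L(n,\mu^1)=q\bigl(L(n,\mu^1)-L(n,\mu^2)\bigr).$$
   Context: For $n\ge1$ let $\delta_{n-1}=(n-1,n-2,\ldots,1)$; for a partition $\lambda$ set $\lambda_j=0$ for $j>\ell(\lambda)$. For $S\subseteq\{1,\ldots,n-1\}$, Gessel's fundamental quasisymmetric function is $F_{n,S}=\sum x_{i_1}\cdots x_{i_n}$ over $1\le i_1\le\cdots\le i_n$ with $i_a<i_{a+1}$ whenever $a\in S$. For a partition $\lambda\subseteq\delta_{n-1}$, the unicellular LLT polynomial is $G_\lambda[X;q]=\sum_{w\in S_n}q^{\mathrm{inv}_\lambda(w)}F_{n,\mathrm{Des}(w)}$, where $w=w_1\cdots w_n$ in one-line notation, $\mathrm{Des}(w)=\{a: w_a>w_{a+1}\}$, and $\mathrm{inv}_\lambda(w)=\#\{(a,b):1\le a<b\le n,\ a>\lambda_{n+1-b},\ w_a>w_b\}$. (This is the LLT polynomial of an $n$-tuple of single cells whose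 cells $x_1,\ldots,x_n$, ordered by shifted content $\tilde c$, satisfy $\lambda_{n+1-b}=\#\{a:\tilde c(x_a)<\tilde c(x_b)-n\}$.) Define $L(n,\lambda)=L(n,\lambda;q)=\omega G_\lambda[X;q]$, where $\omega$ is the involution on symmetric functions with $\omega(h_r)=e_r$.
   Formalization: In the definition of the LLT polynomial, Des(w) is replaced by Des(w^{-1}): with Des(w) as written the first identity fails for n=3, λ=∅, i=1 and G_{(2)} is not symmetric, so ω is undefined on it. *)

(* Defs.v *)
From Stdlib Require Import ClassicalEpsilon.
From mathcomp Require Import all_boot all_order all_fingroup all_algebra.
From mathcomp.multinomials Require Import mpoly.

Set Implicit Arguments.
Unset Strict Implicit.
Unset Printing Implicit Defensive.

Import GRing.Theory.
Local Open Scope ring_scope.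

(* A formal power series in x_1, x_2, ... over Z[q], given by its truncations
   f(x_1, ..., x_N, 0, 0, ...) for all N (Macdonald's inverse limit).  Two
   series are equal when their truncations agree for every N; sums and scalar
   multiples are computed on truncations. *)
Definition series : Type := forall N : nat, {mpoly {poly int}[N]}.

Definition qvar : {poly int} := 'X.

Definition is_partition (la : seq nat) : bool :=
  sorted geq la && (0%N \notin la).

(* The part la_j with the 1-based index of the literature; meaningful only for
   j >= 1, and equal to 0 for j > size la. *)
Definition part (la : seq nat) (j : nat) : nat := nth 0%N la j.-1.

Definition subpart (la mu : seq nat) : Prop :=
  forall j : nat, (1 <= j)%N -> (part la j <= part mu j)%N.

(* staircase m = (m, m-1, ..., 1), denoted delta_m *)
Definition staircase (m : nat) : seq nat := rev (iota 1 m).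

(* la with its i-th part (1-based) increased by a *)
Definition add_to_part (la : seq nat) (i a : nat) : seq nat :=
  iter a (fun s => incr_nth s i.-1) la.

(* F_{n,S}.  Positions are 0-based, so a : 'I_n in S stands for the element
   a+1 of {1, ..., n-1}; the last element n-1 of 'I_n plays no role. *)
Definition Fqsym (n : nat) (S : {set 'I_n}) : series := fun N =>
  \sum_(i : {ffun 'I_n -> 'I_N} |
      [forall a : 'I_n, forall b : 'I_n, (b == a.+1 :> nat) ==>
         ((i a <= i b)%N && ((a \in S) ==> (i a < i b)%N))])
    \prod_(a < n) 'X_(i a).

Definition Des (n : nat) (w : {perm 'I_n}) : {set 'I_n} :=
  [set a : 'I_n | [exists b : 'I_n, (b == a.+1 :> nat) && (w b < w a)%N]].

(* The pair (p.1, p.2) of 0-based positions is (a, b) = (p.1 + 1, p.2 + 1), so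
   a > la_{n+1-b} reads la_{n - p.2} < p.1 + 1. *)
Definition LLT_inv (n : nat) (la : seq nat) (w : {perm 'I_n}) : nat :=
  #|[set p : 'I_n * 'I_n |
      [&& (p.1 < p.2)%N, (part la (n - p.2) < p.1.+1)%N & (w p.2 < w p.1)%N]]|.

(* Here w_a is the entry of the cell x_a.  A filling contributes to the
   fundamental quasisymmetric function of its standardization w, which is
   indexed by the values c such that c+1 occurs to the left of c in w, that is
   by the descents of w^-1.  (With Des w instead, the sum is not symmetric:
   for n = 3 and la = (2), its q^0 part would be F_{3,{}} + 2 F_{3,{2}}.) *)
Definition LLT (n : nat) (la : seq nat) : series := fun N =>
  \sum_(w : {perm 'I_n}) qvar ^+ LLT_inv la w *: Fqsym (Des (w^-1)%g) N.

Definition complete_sym (r : nat) : series := fun N =>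
  \sum_(m : 'X_{1..N < r.+1} | mdeg m == r) 'X_[m].

Definition elementary_sym (r : nat) : series := fun N => mesym N {poly int} r.

(* p(f_1, ..., f_k) for a polynomial p in k variables *)
Definition poly_in (f : nat -> series) (k : nat) (p : {mpoly {poly int}[k]}) :
  series := fun N => p \mPo [tuple f i.+1 N | i < k].

(* omega is the algebra map on symmetric functions with omega(h_r) = e_r:
   every symmetric function is p(h_1, ..., h_k) for some p, and omega sends it
   to p(e_1, ..., e_k), which does not depend on the choice of k and p.
   The value on series that are not symmetric functions is irrelevant. *)
Definition omega_spec (f g : series) : Prop :=
  exists (k : nat) (p : {mpoly {poly int}[k]}),
    (forall N, f N = poly_in complete_sym p N) /\
    (forall N, g N = poly_in elementary_sym p N).

Definition omega (f : series) : series :=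
  epsilon (inhabits (fun N => 0 : {mpoly {poly int}[N]})) (omega_spec f).

Definition L (n : nat) (la : seq nat) : series := omega (LLT n la).

(* Main.v *)
Require Import Defs.
From HB Require Import structures.
From Stdlib Require Import ClassicalEpsilon.
From mathcomp Require Import all_boot all_order all_fingroup all_algebra.
From mathcomp Require Import zify ring.
From mathcomp.multinomials Require Import mpoly.
Set Implicit Arguments.
Unset Strict Implicit.
Unset Printing Implicit Defensive.
Import GRing.Theory.
Local Open Scope ring_scope.

(* By standardization, G_la is the generating function of all words T, weighted
   by q^(number of inversions of T along the edges of a graph).  The graphs of
   mu^0, mu^1, mu^2 differ by two edges (a, b) and (a+1, b), and the hypothesis
   says that a and a+1 are twins in the graph of mu^2.  Exchanging T_a and
   T_(a+1) pairs up the words so that the first relation holds on each pair.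

   To transfer it to L one must know that G_la lies in the domain of omega.
   Symmetry of G_la reduces to words in two letters.  If b is the last vertex,
   inversions a > b may be created one edge at a time; when a has the larger
   letter and b the smaller one, every vertex between them makes exactly one
   inversion with a or b and no vertex before a makes one with a.  Hence the
   two-letter generating function P satisfies
     P(U + b) = (x + y) P(U) + (q - 1) x y sum_a q^(#(U in (a, b))) P(U - a),
   which is symmetric in x and y.  Finally, a stable homogeneous symmetric
   family is one polynomial in the e_r, and since e and h determine each other
   by the same triangular recursion, omega is a well-defined linear map on
   polynomials in the h_r. *)

(** * Words and standardization *)

(** The power of q is kept as a product over edges, so that the factor of a single edge can be split
    off. *)
Definition inv_weight n N (E : rel 'I_n) (T : {ffun 'I_n -> 'I_N}) : {poly int} :=
  \prod_(p : 'I_n * 'I_n | E p.1 p.2) (if (T p.2 < T p.1)%N then qvar else 1).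

Definition words_gf n (E : rel 'I_n) : series := fun N =>
  \sum_(T : {ffun 'I_n -> 'I_N}) inv_weight E T *: \prod_(a < n) 'X_(T a).

Definition attack n (la : seq nat) : rel 'I_n :=
  fun a b => (a < b)%N && (part la (n - b) < a.+1)%N.

Lemma card_ord_lt n k : (k <= n)%N -> #|[set c : 'I_n | (c < k)%N]| = k.
Proof.
move=> kn; rewrite -sum1dep_card -(big_ord_widen _ (fun _ => 1%N)) //.
by rewrite sum1_card card_ord.
Qed.

Section Standardization.
Variables (n N : nat) (T : {ffun 'I_n -> 'I_N}).

(* Orders the positions by letter, ties being broken from left to right. *)
Let key (u : 'I_n) : nat := (T u * n + u)%N.

Let key_lt u v : (key u < key v)%N = (T u < T v)%N || ((T u == T v :> nat) && (u < v)%N).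
Proof.
rewrite /key; have := ltn_ord u; have := ltn_ord v.
move: (nat_of_ord u) (nat_of_ord v) (nat_of_ord (T u)) (nat_of_ord (T v)) => a b s t bn an.
case: (ltngtP s t) => [st|ts|->] /=; last by rewrite ltn_add2l.
  by apply/idP; nia.
by apply/negbTE; rewrite -leqNgt; nia.
Qed.

Let key_inj : injective key.
Proof.
move=> u v uv; apply: val_inj => /=; apply/eqP.
have := key_lt u v; have := key_lt v u; rewrite uv ltnn /= => /esym H1 /esym H2.
by move: H1 H2; case: (ltngtP (T u) (T v)) => //= _; case: ltngtP.
Qed.

Let rank_subproof u : (#|[set v | (key v < key u)%N]| < n)%N.
Proof.
rewrite -[X in (_ < X)%N](card_ord n) -cardsT; apply: proper_card.
by rewrite properT; apply/eqP => /setP /(_ u); rewrite !inE ltnn.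
Qed.

Let rank u := Ordinal (rank_subproof u).

Let rank_lt u v : (rank u < rank v)%N = (key u < key v)%N.
Proof.
have lt u' v' : (key u' < key v')%N -> (rank u' < rank v')%N.
  move=> uv; apply: proper_card; apply/properP; split.
    by apply/subsetP => w; rewrite !inE => /ltn_trans; apply.
  by exists u'; rewrite inE ?ltnn.
apply/idP/idP => [|/lt//]; apply: contraTT; rewrite -!leqNgt leq_eqVlt.
by case/orP=> [/eqP /key_inj ->//|/lt /ltnW].
Qed.

Let rank_inj : injective rank.
Proof.
move=> u v uv; apply: key_inj; apply/eqP.
have := rank_lt u v; have := rank_lt v u; rewrite uv ltnn.
by case: (ltngtP (key u) (key v)).
Qed.

Definition standardization : {perm 'I_n} := perm rank_inj.

(** Ties are ranked from left to right, so equal letters create no inversion. *)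
Lemma standardization_lt (u v : 'I_n) : (u < v)%N ->
  (standardization v < standardization u)%N = (T v < T u)%N.
Proof.
move=> uv; rewrite !permE rank_lt key_lt.
by rewrite [(v < u)%N]ltnNge (ltnW uv) andbF orbF.
Qed.

(** The condition makes the keys increase along the values of [w^-1]: a tie is allowed exactly where
    [w^-1] has no descent. Only sorting by key achieves this, so each word is counted for a single
    [w]. *)
Lemma Fqsym_index_standardization (w : {perm 'I_n}) :
  [forall a : 'I_n, forall b : 'I_n, (b == a.+1 :> nat) ==>
     ((T (w^-1%g a) <= T (w^-1%g b))%N
       && ((a \in Des w^-1%g) ==> (T (w^-1%g a) < T (w^-1%g b))%N))]
  = (w == standardization).
Proof.
transitivity [forall a : 'I_n, forall b : 'I_n, (b == a.+1 :> nat) ==>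
     (key (w^-1%g a) < key (w^-1%g b))%N].
  apply: eq_forallb => a; apply: eq_forallb => b; case: eqP => //= ba.
  have -> : (a \in Des w^-1%g) = (w^-1%g b < w^-1%g a)%N.
    rewrite inE; apply/existsP/idP => [[c /andP[/eqP cE]]|ltba]; last first.
      by exists b; rewrite ba eqxx.
    by have -> : c = b by apply: val_inj; rewrite /= cE ba.
  have nab : w^-1%g a != w^-1%g b.
    by rewrite (inj_eq perm_inj) -val_eqE /= ba neq_ltn ltnSn.
  rewrite key_lt; case: (ltngtP (T (w^-1%g a)) (T (w^-1%g b))) => //= _.
    by rewrite implybT.
  rewrite implybF -leqNgt leq_eqVlt.
  by case: eqP => //= /val_inj /eqP; rewrite (negbTE nab).
apply/forallP/eqP => [H|-> a].
  have mono (c d : 'I_n) : (c < d)%N -> (key (w^-1%g c) < key (w^-1%g d))%N.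
    case: d => d; elim: d => //= d IHd dn; rewrite ltnS leq_eqVlt => /orP[/eqP cd|cd].
      by have /forallP /(_ (Ordinal dn)) /implyP := H c; apply; rewrite cd.
    apply: ltn_trans (IHd (ltnW dn) cd) _.
    by have /forallP /(_ (Ordinal dn)) := H (Ordinal (ltnW dn)); rewrite /= eqxx.
  apply/permP => u; apply: val_inj; rewrite permE /=.
  (* [w u] counts the values below it, and [w^-1] carries these to the positions of smaller key,
     which [rank u] counts. *)
  rewrite -[LHS](@card_ord_lt n); last exact: ltnW.
  rewrite -(card_imset _ (@perm_inj _ w^-1%g)); apply: eq_card => v; rewrite inE.
  apply/imsetP/idP => [[c]|uv].
    by rewrite inE => /mono; rewrite permK => ? ->.
  exists (w v); rewrite ?permK // inE ltnNge; apply: contraL uv => uv.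
  rewrite -leqNgt; move: uv; rewrite leq_eqVlt => /orP[/eqP /val_inj /perm_inj -> //|].
  by move/mono; rewrite !permK => /ltnW.
apply/forallP => b; apply/implyP => /eqP ba; rewrite -rank_lt.
by rewrite -!(permE rank_inj) !permKV ba.
Qed.

End Standardization.

Lemma LLT_words n la N : LLT n la N = words_gf (@attack n la) N.
Proof.
rewrite /LLT /words_gf /Fqsym.
pose r (w : {perm 'I_n}) (T : {ffun 'I_n -> 'I_N}) : {ffun 'I_n -> 'I_N} :=
  [ffun c => T (w^-1%g c)].
(* An index sequence [i] of [Fqsym] becomes the word $T = i \circ w$, whose standardization must be
   [w]. *)
transitivity (\sum_(w : {perm 'I_n}) \sum_(T | w == standardization T)
    qvar ^+ LLT_inv la w *: \prod_(c < n) 'X_(r w T c) : {mpoly {poly int}[N]}).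
  apply: eq_bigr => w _; rewrite -scaler_sumr (reindex (r w)) /=; last first.
    exists (fun i => [ffun a => i (w a)]) => i _; apply/ffunP => a.
      by rewrite !ffunE permK.
    by rewrite !ffunE permKV.
  congr (_ *: _); apply: eq_bigl => T.
  rewrite -Fqsym_index_standardization; apply: eq_forallb => a.
  by apply: eq_forallb => b; rewrite !ffunE.
rewrite (exchange_big_dep xpredT) //=; apply: eq_bigr => T _.
rewrite big_pred1_eq; congr (_ *: _); last first.
  rewrite (reindex_inj (@perm_inj _ (standardization T))) /=.
  by apply: eq_bigr => a _; rewrite ffunE permK.
rewrite /LLT_inv -prodr_const /inv_weight -big_mkcondr /=; apply: eq_bigl => p.
rewrite !inE /attack; have [uv|//] := ltnP p.1 p.2.
by rewrite /= standardization_lt.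
Qed.

(** * The linear relation *)

Lemma mpoly_poly_int_addrr_eq0 N (p : {mpoly {poly int}[N]}) : p + p = 0 -> p = 0.
Proof.
move=> pp; apply/mpolyP => m; apply/polyP => j; rewrite mcoeff0 coef0.
have := congr1 (fun r : {mpoly {poly int}[N]} => (r@_m)`_j) pp.
rewrite /= mcoeffD coefD mcoeff0 coef0 -mulr2n => /eqP.
by rewrite Num.Theory.mulrn_eq0 => /eqP.
Qed.

Section LinearRelation.
Variables (n : nat) (E0 E1 E2 : rel 'I_n) (a a' b : 'I_n).
Hypotheses (aa' : (a < a')%N) (a'b : (a' < b)%N).
Hypotheses (E0ab : E0 a b) (E1a'b : E1 a' b) (E2aa' : E2 a a') (E2a'a : E2 a' a = false).
Hypothesis E1E : forall u v, E1 u v = E0 u v && ((u, v) != (a, b)).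
Hypothesis E2E : forall u v, E2 u v = E1 u v && ((u, v) != (a', b)).
Hypothesis E2_twins : forall u v, (u, v) != (a, a') -> (u, v) != (a', a) ->
  E2 (tperm a a' u) (tperm a a' v) = E2 u v.

(* Exchanging the letters on the twins a and a' pairs up the terms of the
   difference of the two sides, and the terms of each pair cancel. *)
Lemma words_gf_linear_relation N :
  words_gf E0 N - words_gf E1 N = qvar *: (words_gf E1 N - words_gf E2 N).
Proof.
pose c (x y : nat) : {poly int} := if (y < x)%N then qvar else 1.
(* [r] is invariant under the exchange of the twins; [d], at the letters of [a], [a'] and [b], is
   what remains of left side minus right side once [r] is factored out. *)
pose r (T : {ffun 'I_n -> 'I_N}) : {poly int} :=
  \prod_(p : 'I_n * 'I_n | E2 p.1 p.2 && (p != (a, a'))) c (T p.1) (T p.2).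
pose d x y z : {poly int} :=
  c x y * (c x z * c y z - c y z - qvar * c y z + qvar).
have w2 T : inv_weight E2 T = c (T a) (T a') * r T.
  by rewrite /inv_weight (bigD1 (a, a')).
have w1 T : inv_weight E1 T = c (T a') (T b) * inv_weight E2 T.
  rewrite /inv_weight (bigD1 (a', b)) //=; congr (_ * _).
  by apply: eq_bigl => -[u v]; rewrite E2E.
have w0 T : inv_weight E0 T = c (T a) (T b) * inv_weight E1 T.
  rewrite /inv_weight (bigD1 (a, b)) //=; congr (_ * _).
  by apply: eq_bigl => -[u v]; rewrite E1E.
pose m (T : {ffun 'I_n -> 'I_N}) : {mpoly {poly int}[N]} := \prod_(v < n) 'X_(T v).
pose S := \sum_(T : {ffun 'I_n -> 'I_N}) (r T * d (T a) (T a') (T b)) *: m T.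
suff S0 : S = 0.
  apply/eqP; rewrite -subr_eq0; apply/eqP; rewrite -[RHS]S0 /words_gf /S.
  rewrite -!sumrB scaler_sumr -sumrB; apply: eq_bigr => T _.
  rewrite -!scalerBl scalerA -scalerBl w0 w1 w2 /d; congr (_ *: _); ring.
apply: mpoly_poly_int_addrr_eq0; set s := tperm a a'.
have sK : involutive s by move=> u; rewrite /s tpermK.
have eS : S = \sum_(T : {ffun 'I_n -> 'I_N}) (r T * d (T a') (T a) (T b)) *: m T.
  pose h (T : {ffun 'I_n -> 'I_N}) : {ffun 'I_n -> 'I_N} := [ffun u => T (s u)].
  have hK : involutive h by move=> T; apply/ffunP => u; rewrite !ffunE sK.
  rewrite /S (reindex_inj (inv_inj hK)) /=; apply: eq_bigr => T _.
  have -> : m (h T) = m T.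
    rewrite /m (reindex_inj (@perm_inj _ s)) /=.
    by apply: eq_bigr => u _; rewrite ffunE sK.
  have -> : r (h T) = r T.
    pose s2 (p : 'I_n * 'I_n) := (s p.1, s p.2).
    have s2K : involutive s2 by case=> u v; rewrite /s2 /= !sK.
    rewrite /r (reindex_inj (inv_inj s2K)) /=; apply: eq_big => [[u v]|[u v] _] /=; last first.
      by rewrite !ffunE !sK.
    have [[-> ->]|nuv] := eqVneq (u, v) (a, a').
      by rewrite /s /s2 tpermL tpermR E2a'a andbF.
    have [[-> ->]|nvu] := eqVneq (u, v) (a', a).
      by rewrite /s2 /s /= tpermL tpermR E2a'a eqxx andbF.
    by rewrite E2_twins // (inv_eq s2K) /s2 /s /= tpermL tpermR (negbTE nvu).
  have nba : b != a by rewrite -val_eqE /= gtn_eqF // (ltn_trans aa').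
  have nba' : b != a' by rewrite -val_eqE /= gtn_eqF.
  by rewrite !ffunE /s tpermL tpermR tpermD // eq_sym.
rewrite {1}eS /S -big_split /= big1 // => T _.
rewrite -scalerDl -mulrDr [X in _ * X](_ : _ = 0) ?mulr0 ?scale0r //.
(* The identity [d x y z + d y x z = 0] is checked for each relative order of the letters; for
   [x = y] it reads $2(c-1)(c-q)=0$ with $c\in\{1,q\}$. *)
rewrite /d /c.
by case: (ltngtP (T a) (T a')); case: (ltnP (T b) (T a)); case: (ltnP (T b) (T a')) => *;
  try ring; exfalso; lia.
Qed.

End LinearRelation.

(** * Words in two letters *)

Lemma sum_subsets_mem (T : finType) (V : nmodType) (a : T) (U : {set T})
    (F : {set T} -> V) : a \in U ->
  \sum_(S : {set T} | (S \subset U) && (a \in S)) F S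
  = \sum_(S : {set T} | S \subset U :\ a) F (a |: S).
Proof.
move=> aU; rewrite (reindex_onto (fun S => a |: S) (fun S => S :\ a)) /=; last first.
  by move=> S /andP[_ aS]; rewrite setD1K.
apply: eq_bigl => S; rewrite setU11 andbT subUset sub1set aU /= subsetD1.
case aS: (a \in S) => /=; last by rewrite setU1K ?aS // eqxx !andbT.
rewrite andbF; apply/negbTE/nandP; right; apply/eqP => /setP /(_ a).
by rewrite !inE eqxx aS.
Qed.

Lemma sum_subsets_setU1 (T : finType) (V : nmodType) (a : T) (U : {set T})
    (F : {set T} -> V) : a \notin U ->
  \sum_(S : {set T} | S \subset a |: U) F S
  = \sum_(S : {set T} | S \subset U) F S
    + \sum_(S : {set T} | S \subset U) F (a |: S).
Proof.
move=> aU; rewrite (bigID (fun S : {set T} => a \in S)) /= addrC; congr (_ + _).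
  apply: eq_bigl => S; apply/andP/idP => [[SU aS]|SU].
    by rewrite -(setU1K aU) subsetD1 SU.
  split; first exact: subset_trans SU (subsetU1 _ _).
  by apply: contra aU; apply: (subsetP SU).
by rewrite sum_subsets_mem ?setU11 // setU1K.
Qed.

(** The terms of the expanded product that contain some [h] are grouped by the least index [a] at
    which [h a] is taken. *)
Lemma prod_telescope (R : comPzRingType) (n : nat) (h : 'I_n -> R)
    (S : {set 'I_n}) :
  \prod_(a in S) (1 + h a)
  = 1 + \sum_(a in S) h a * \prod_(b in S | (a < b)%N) (1 + h b).
Proof.
have [k leSk] := ubnP #|S|; elim: k S leSk => // k IHk S ltSk.
have [->|[a0 a0S]] := set_0Vmem S; first by rewrite !big_set0 addr0.
case: (arg_minnP (fun a : 'I_n => a : nat) a0S) => a aS0 a_min; have {aS0} aS : a \in S := aS0.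
have aI b : b \in S :\ a -> (a < b)%N.
  by case/setD1P=> nba bS; rewrite ltn_neqAle eq_sym nba a_min.
have ltSa : (#|S :\ a| < k)%N by rewrite -ltnS (leq_trans _ ltSk) // (cardsD1 a S) aS.
rewrite (big_setD1 a aS) [X in _ = 1 + X](big_setD1 a aS) /=.
have -> : \prod_(b in S | (a < b)%N) (1 + h b) = \prod_(b in S :\ a) (1 + h b).
  apply: eq_bigl => b; rewrite andbC.
  have [ab|ba] := ltnP a b; first by rewrite !inE (gtn_eqF ab : (b == a) = false).
  by apply/esym/negbTE/negP => /aI; rewrite ltnNge ba.
rewrite mulrDl mul1r {1}(IHk _ ltSa) -addrA [_ + h a * _]addrC.
congr (_ + (_ + _)); apply: eq_bigr => c /aI ac; congr (_ * _); apply: eq_bigl => b.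
rewrite !inE; case: eqVneq => //= ->.
by rewrite [(c < a)%N]ltnNge (ltnW ac) andbF.
Qed.

Section TwoColours.
Variables (R : comPzRingType) (n : nat) (E : rel 'I_n) (q : R).
Hypothesis E_lt : forall a b, E a b -> (a < b)%N.
Hypothesis E_itv : forall a b c : 'I_n,
  (a < b)%N -> (b < c)%N -> E a c -> E a b && E b c.

Let ew a b : R := if E a b then q else 1.

(* S is the set of positions of the larger of the two letters. *)
Definition two_colour_gf (x y : R) (U : {set 'I_n}) : R :=
  \sum_(S : {set 'I_n} | S \subset U)
    (\prod_(a in S) \prod_(b in U :\: S) (if E a b then q else 1))
    * (x ^+ #|S| * y ^+ #|U :\: S|).

Lemma two_colour_gf_max x y (b : 'I_n) (U : {set 'I_n}) :
    (forall a, a \in U -> (a < b)%N) ->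
  two_colour_gf x y (b |: U)
  = (x + y) * two_colour_gf x y U
    + \sum_(a in U | E a b) (q - 1) * q ^+ #|[set v in U | (a < v)%N]|
        * (x * y) * two_colour_gf x y (U :\ a).
Proof.
move=> b_max; have bU : b \notin U by apply/negP => /b_max; rewrite ltnn.
have b_max' (S : {set 'I_n}) : S \subset U -> b \notin S.
  by move=> SU; apply: contra bU; apply: (subsetP SU).
rewrite {1}/two_colour_gf sum_subsets_setU1 // addrC [_ * two_colour_gf _ _ _]mulrDl -addrA.
congr (_ + _).
  (* If [b] carries the larger letter it contributes only [x], since no edge leads from [b] into
     [U]. *)
  rewrite mulr_sumr; apply: eq_bigr => S SU.
  have bS := b_max' _ SU.
  have -> : (b |: U) :\: (b |: S) = U :\: S.
    apply/setP => v; rewrite !inE negb_or.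
    by case: eqVneq => //= ->; rewrite (negbTE bU) andbF.
  rewrite big_setU1 //= cardsU1 bS exprS big1 ?mul1r; first by ring.
  move=> v /setDP[vU _]; case: ifP => // /E_lt.
  by rewrite ltnNge ltnW // b_max.
(* If [b] carries the smaller letter, each larger letter at [a] contributes [1 + h a]; this product
   is then telescoped. *)
pose h a : R := if E a b then q - 1 else 0.
pose t (V S : {set 'I_n}) := \prod_(a in S) \prod_(c in V :\: S) ew a c
    * (x ^+ #|S| * y ^+ #|V :\: S|).
have -> : \sum_(S : {set 'I_n} | S \subset U)
     \prod_(a in S) \prod_(b0 in (b |: U) :\: S) (if E a b0 then q else 1) *
     (x ^+ #|S| * y ^+ #|(b |: U) :\: S|)
  = \sum_(S : {set 'I_n} | S \subset U) y * (t U S * \prod_(a in S) (1 + h a)).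
  apply: eq_bigr => S SU; have bS := b_max' _ SU.
  have -> : (b |: U) :\: S = b |: (U :\: S).
    by apply/setP => v; rewrite !inE; case: eqVneq => //= ->; rewrite bS.
  have bUS : b \notin U :\: S by rewrite inE negb_and bU orbT.
  rewrite cardsU1 bUS exprS.
  rewrite (eq_bigr (fun a => (1 + h a) * \prod_(c in U :\: S) ew a c)).
    rewrite big_split /= /t; ring.
  move=> a _; rewrite big_setU1 //= /ew /h; congr (_ * _); case: ifP => _; ring.
rewrite -mulr_sumr (eq_bigr (fun S => t U S + t U S *
   (\sum_(a in S) h a * \prod_(b in S | (a < b)%N) (1 + h b)))); last first.
  by move=> S _; rewrite prod_telescope mulrDr mulr1.
rewrite big_split /= mulrDr; congr (_ + _).
under eq_bigr do rewrite mulr_sumr.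
rewrite (exchange_big_dep (mem U)) /=; last by move=> S a /subsetP; apply.
rewrite mulr_sumr [RHS]big_mkcondr /=; apply: eq_bigr => a aU.
rewrite sum_subsets_mem // {1}/h; case: ifP => Eab; last first.
  by rewrite big1 ?mulr0 // => S _; rewrite mul0r mulr0.
rewrite /two_colour_gf !mulr_sumr; apply: eq_bigr => S SUa.
have [SU aS] : S \subset U /\ a \notin S by move: SUa; rewrite subsetD1 => /andP.
have -> : t U (a |: S) = x * ((\prod_(c in (U :\ a) :\: S) ew a c) * t (U :\ a) S).
  rewrite /t; have -> : U :\: (a |: S) = (U :\ a) :\: S.
    by apply/setP => v; rewrite !inE negb_or andbA [~~ _ && (v != a)]andbC.
  rewrite big_setU1 //= cardsU1 aS exprS; ring.
(* As [E a b] holds, every [c] between [a] and [b] is joined to both, so [1 + h c] and [ew a c] are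
   both [q]; for [c] before [a], [ew a c] is 1. *)
have -> : \prod_(b0 in a |: S | (a < b0)%N) (1 + h b0) = \prod_(c in S) ew a c.
  rewrite big_mkcondr big_setU1 //= ltnn mul1r; apply: eq_bigr => c cS.
  have cb : (c < b)%N by apply: b_max; apply: (subsetP SU).
  rewrite /ew /h; have [ac|ca] := ltnP a c.
    by have /andP[-> ->] := E_itv ac cb Eab; rewrite addrC subrK.
  by case: ifP => // /E_lt; rewrite ltnNge ca.
(* Each vertex of [U] after [a] now gives one factor [q], whether or not it lies in [S], so the
   exponent is independent of [S]. *)
have Pq : (\prod_(c in S) ew a c) * \prod_(c in U :\ a :\: S) ew a c
    = q ^+ #|[set v in U | (a < v)%N]|.
  transitivity (\prod_(c in U :\ a) ew a c).
    by rewrite [RHS](big_setID S) /= (setIidPr SUa).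
  rewrite /ew -big_mkcondr /= -prodr_const; apply: eq_bigl => c; rewrite !inE.
  have [ac|ca] := ltnP a c; last first.
    by rewrite !andbF; apply/negP => /andP[_] /E_lt; rewrite ltnNge ca.
  rewrite (gtn_eqF ac : (c == a) = false) /=; case cU: (c \in U) => //=.
  by have /andP[-> _] := E_itv ac (b_max _ cU) Eab.
rewrite -Pq /t; ring.
Qed.

Lemma two_colour_gfC x y (U : {set 'I_n}) :
  two_colour_gf x y U = two_colour_gf y x U.
Proof.
have [k leUk] := ubnP #|U|; elim: k U leUk => // k IHk U ltUk.
have [->|[b0 b0U]] := set_0Vmem U.
  rewrite /two_colour_gf; apply: eq_bigr => S; rewrite subset0 => /eqP->.
  by rewrite setD0 cards0.
case: (arg_maxnP (fun a : 'I_n => a : nat) b0U) => b bU0 b_max; have {bU0} bU : b \in U := bU0.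
have ltUb : (#|U :\ b| < k)%N by rewrite -ltnS (leq_trans _ ltUk) // (cardsD1 b U) bU.
rewrite -(setD1K bU) !two_colour_gf_max; first last.
- by move=> a /setD1P[nab aU]; rewrite ltn_neqAle nab; apply: b_max.
- by move=> a /setD1P[nab aU]; rewrite ltn_neqAle nab; apply: b_max.
rewrite addrC IHk // addrC [x + y]addrC; congr (_ + _).
apply: eq_bigr => a _; rewrite IHk; first by rewrite [x * y]mulrC.
by apply: leq_ltn_trans ltUb; apply: subset_leq_card; apply: subsetDl.
Qed.

End TwoColours.

(** * Symmetry of the generating function of words *)

Lemma msymXU (R : nzRingType) N (s : 'S_N) (i : 'I_N) :
  msym s ('X_i : {mpoly R[N]}) = 'X_(s i).
Proof. by rewrite /msym mmapX mmap1U. Qed.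

(** A transposition of distant indices is a closer one conjugated by an adjacent one, and
    transpositions generate the symmetric group. *)
Lemma symmetric_adjacent (R : nzRingType) N (p : {mpoly R[N]}) :
  (forall i j : 'I_N, j = i.+1 :> nat -> msym (tperm i j) p = p) ->
  p \is symmetric.
Proof.
move=> padj.
have plt (i j : 'I_N) : (i < j)%N -> msym (tperm i j) p = p.
  case: j => j; elim: j => // j IHj jN; rewrite /= ltnS leq_eqVlt.
  case/orP=> [/eqP ij|ij]; first by apply: padj; rewrite /= ij.
  pose k := Ordinal (ltnW jN).
  have -> : tperm i (Ordinal jN) = (tperm i k ^ tperm k (Ordinal jN))%g.
    rewrite tpermJ tpermL tpermD // -val_eqE /= gtn_eqF //.
    exact: leq_trans ij _.
  by rewrite conjgE tpermV !msymMm padj // IHj // padj.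
have ptperm i j : msym (tperm i j) p = p.
  case: (ltngtP i j) => [/plt //|ji|/val_inj ->]; last by rewrite tperm1 msym1m.
  by rewrite tpermC plt.
apply/issymP => s; have [ts -> _] := prod_tpermP s.
elim: ts => [|t ts IHts]; first by rewrite big_nil msym1m.
by rewrite big_cons msymMm ptperm.
Qed.

Lemma rmorph_two_colour_gf (R S : comPzRingType) (f : {rmorphism R -> S}) n
    (E : rel 'I_n) q x y U :
  f (two_colour_gf E q x y U) = two_colour_gf E (f q) (f x) (f y) U.
Proof.
rewrite /two_colour_gf rmorph_sum; apply: eq_bigr => T _.
rewrite !rmorphM !rmorphXn rmorph_prod; congr (_ * _); apply: eq_bigr => a _.
by rewrite rmorph_prod; apply: eq_bigr => b _; case: ifP; rewrite ?rmorph1.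
Qed.

Section Symmetry.
Variables (n N : nat) (E : rel 'I_n).
Hypothesis E_lt : forall a b : 'I_n, E a b -> (a < b)%N.
Hypothesis E_itv : forall a b c : 'I_n,
  (a < b)%N -> (b < c)%N -> E a c -> E a b && E b c.

(* The words that become T0 when every letter j = i + 1 is replaced by i. *)
Lemma words_gf_fibre (i j : 'I_N) (T0 : {ffun 'I_n -> 'I_N}) :
    j = i.+1 :> nat -> (forall a, T0 a != j) ->
    let U := [set a | T0 a == i] in
  exists2 K : {mpoly {poly int}[N]}, msym (tperm i j) K = K &
  \sum_(T : {ffun 'I_n -> 'I_N} | [ffun a => if T a == j then i else T a] == T0)
     inv_weight E T *: \prod_(a < n) 'X_(T a)
  = K * two_colour_gf E qvar%:MP 'X_j 'X_i U.
Proof.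
move=> ji T0j U.
have nij : (i == j) = false by apply/negbTE; rewrite -val_eqE /= ji neq_ltn ltnSn.
pose fill (S : {set 'I_n}) : {ffun 'I_n -> 'I_N} :=
  [ffun a => if a \in S then j else T0 a].
(* [C] comes from the edges with an end outside [U] and [M] from the positions outside [U]. Neither
   depends on [S]: a letter other than [i] and [j] compares in the same way with [i] and with
   [j = i + 1]. *)
pose C : {poly int} := \prod_(p : 'I_n * 'I_n | E p.1 p.2)
  (if (p.1 \in U) && (p.2 \in U) then 1
   else if (T0 p.2 < T0 p.1)%N then qvar else 1).
pose M : {mpoly {poly int}[N]} := \prod_(a < n) (if a \in U then 1 else 'X_(T0 a)).
exists (C%:MP * M).
  rewrite msymM /msym mmapC -/(msym _ M); congr (_ * _).
  rewrite /M [LHS]rmorph_prod; apply: eq_bigr => a _; rewrite inE.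
  case: eqVneq => [_|T0i]; first by rewrite [LHS]rmorph1.
  by rewrite /= msymXU tpermD // eq_sym // T0j.
rewrite (reindex_onto fill (fun T : {ffun _} => [set a | T a == j])) /=; last first.
  move=> T /eqP TE; apply/ffunP => a; rewrite ffunE inE -TE ffunE.
  by case: eqP.
rewrite /two_colour_gf mulr_sumr; apply: eq_big => [S|S SU].
  apply/andP/idP => [[/eqP/ffunP H _]|/subsetP SU].
    by apply/subsetP => a aS; move: (H a); rewrite !ffunE aS eqxx inE => <-.
  split; last first.
    apply/eqP/setP => a; rewrite inE ffunE; case: ifP => [_|_]; first exact: eqxx.
    exact/negbTE/T0j.
  apply/eqP/ffunP => a; rewrite !ffunE; case aS: (a \in S).
    by have := SU _ aS; rewrite inE eqxx => /eqP.
  by rewrite (negbTE (T0j a)).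
have {}SU : S \subset U.
  case/andP: SU => /eqP/ffunP H _.
  by apply/subsetP => a aS; move: (H a); rewrite !ffunE aS eqxx inE => <-.
have fillE a : fill S a = if a \in S then j else if a \in U then i else T0 a.
  by rewrite ffunE inE; case: ifP => // _; case: eqP.
have -> : inv_weight E (fill S)
    = C * \prod_(a in S) \prod_(b in U :\: S) (if E a b then qvar else 1).
  rewrite pair_big /= /inv_weight /C [X in _ = _ * X]big_mkcond.
  rewrite [X in X * _]big_mkcond [LHS]big_mkcond -big_split /=.
  apply: eq_bigr => -[a b] _ /=; rewrite !fillE !in_setD.
  have notS c : c \notin U -> c \in S = false.
    by move=> cU; apply/negbTE; apply: contra cU; apply: (subsetP SU).
  have cmpU c : c \notin U ->
      ((T0 c < j)%N = (T0 c < i)%N) * ((j < T0 c)%N = (i < T0 c)%N).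
    move=> cU; have ci : T0 c != i :> nat by rewrite inE in cU.
    have cj : T0 c != j :> nat by apply: T0j.
    by rewrite ji; split; lia.
  case: (E a b); last by case: ifP; rewrite ?mul1r.
  have [aU|aU] := boolP (a \in U); have [bU|bU] := boolP (b \in U); rewrite /= ?mul1r.
  - by case: (a \in S); case: (b \in S); rewrite /= ?ji ?ltnn ?ltnSn // ltnNge leqnSn.
  - have -> : T0 a = i by apply/eqP; rewrite inE in aU.
    by rewrite (notS b) //= andbF mulr1; case: (a \in S); rewrite ?cmpU.
  - have -> : T0 b = i by apply/eqP; rewrite inE in bU.
    by rewrite (notS a) //= mulr1; case: (b \in S); rewrite ?cmpU.
  - by rewrite (notS a) // (notS b) //= mulr1.
have -> : \prod_(a < n) 'X_(fill S a) = M * ('X_j ^+ #|S| * 'X_i ^+ #|U :\: S|)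
    :> {mpoly {poly int}[N]}.
  rewrite /M -!prodr_const [in X in _ * X]big_mkcond [X in _ * (_ * X)]big_mkcond.
  rewrite -!big_split /=; apply: eq_bigr => a _; rewrite fillE in_setD.
  case aS: (a \in S) => /=; first by rewrite (subsetP SU _ aS) mul1r mulr1.
  by case: (a \in U); rewrite ?mulr1 ?mul1r.
rewrite -mul_mpolyC rmorphM /= mulrACA; congr (_ * (_ * _)).
rewrite rmorph_prod; apply: eq_bigr => a _; rewrite rmorph_prod.
by apply: eq_bigr => b _; case: ifP; rewrite ?rmorph1.
Qed.

Lemma words_gf_symmetric : words_gf E N \is symmetric.
Proof.
apply: symmetric_adjacent => i j ji; rewrite /words_gf.
rewrite (partition_big (fun T : {ffun 'I_n -> 'I_N} =>
   [ffun a => if T a == j then i else T a]) xpredT) //=.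
rewrite [LHS]rmorph_sum; apply: eq_bigr => T0 _.
(* Merged words do not contain [j], so the fibre over a [T0] that uses [j] is empty. *)
have [/forallP T0j|] := boolP [forall a, T0 a != j]; last first.
  rewrite negb_forall => /existsP[a]; rewrite negbK => /eqP T0a.
  rewrite big_pred0; first exact: rmorph0.
  move=> T; apply/eqP => /ffunP /(_ a); rewrite ffunE T0a.
  case: ifP => [_|/eqP //] ij; have := ltnn i; by rewrite {2}ij ji ltnSn.
have [K Ksym ->] := words_gf_fibre ji T0j.
rewrite [LHS]rmorphM /= Ksym; congr (_ * _).
have msymC : msym (tperm i j) qvar%:MP = qvar%:MP :> {mpoly {poly int}[N]}.
  exact: mmapC.
apply: etrans (rmorph_two_colour_gf (msym (tperm i j)) _ _ _ _ _) _.
by rewrite /= msymC !msymXU tpermL tpermR (two_colour_gfC _ E_lt E_itv).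
Qed.

End Symmetry.

(** * Stable symmetric polynomials *)

Lemma comp_mpolyA (R : comNzRingType) (k l m : nat) (p : {mpoly R[k]})
    (t : k.-tuple {mpoly R[l]}) (u : l.-tuple {mpoly R[m]}) :
  (p \mPo t) \mPo u = p \mPo [tuple tnth t i \mPo u | i < k].
Proof.
rewrite (comp_mpolyEX p) raddf_sum [RHS]comp_mpolyEX; apply: eq_bigr => e _.
rewrite [LHS]comp_mpolyZ; congr (_ *: _); rewrite !comp_mpolyX rmorph_prod.
by apply: eq_bigr => i _; rewrite rmorphXn tnth_mktuple.
Qed.

Lemma lift_max_widen (N : nat) (j : 'I_N) :
  lift ord_max j = widen_ord (leqnSn N) j.
Proof. by apply: val_inj; apply: lift_max. Qed.

Section Restriction.
Variables (R : comNzRingType) (N : nat).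

(** The transition map of the inverse limit: [unlift ord_max i] is [None] exactly at the last
    variable, which is sent to 0. *)
Definition set_last0 (p : {mpoly R[N.+1]}) : {mpoly R[N]} :=
  p \mPo [tuple oapp (fun j => 'X_j) 0 (unlift ord_max i) | i < N.+1].

HB.instance Definition _ := GRing.LRMorphism.copy set_last0
  (comp_mpoly
     [tuple oapp (fun j : 'I_N => 'X_j : {mpoly R[N]}) 0 (unlift ord_max i)
        | i < N.+1]).

Lemma set_last0Xmax : set_last0 'X_ord_max = 0.
Proof. by rewrite /set_last0 comp_mpolyXU -tnth_nth tnth_mktuple unlift_none. Qed.

Lemma set_last0Xlift j : set_last0 'X_(lift ord_max j) = 'X_j.
Proof. by rewrite /set_last0 comp_mpolyXU -tnth_nth tnth_mktuple liftK. Qed.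

(** The power [0 ^+ m ord_max] is 1 when the last variable is absent from the monomial, and 0
    otherwise. *)
Lemma set_last0X (m : 'X_{1..N.+1}) :
  set_last0 'X_[m] = 0 ^+ m ord_max * 'X_[[multinom m (lift ord_max j) | j < N]].
Proof.
rewrite /set_last0 comp_mpolyX big_ord_recr /= mulrC tnth_mktuple unlift_none /=.
congr (_ * _); rewrite [RHS]mpolyXE_id; apply: eq_bigr => j _.
by rewrite -lift_max_widen tnth_mktuple liftK mnmE.
Qed.

Lemma mcoeff_set_last0 p m : (set_last0 p)@_m = p@_(mnmwiden m).
Proof.
rewrite {2}[p]mpolyE [set_last0 p]comp_mpolyEX !raddf_sum /=; apply: eq_bigr => k _.
rewrite -/(set_last0 _) !mcoeffZ set_last0X mcoeffX; congr (_ * _).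
have [->|nk] := eqVneq k (mnmwiden m).
  rewrite mnmwiden_ordmax expr0 mul1r mcoeffX.
  suff -> : [multinom mnmwiden m (lift ord_max j) | j < N] == m by [].
  by apply/eqP/mnmP => j; rewrite mnmE lift_max_widen mnmwiden_widen.
case km: (k ord_max) => [|r]; last by rewrite exprS !mul0r mcoeff0.
rewrite expr0 mul1r mcoeffX; case: eqP => // mk; case/eqP: nk.
apply/mnmP => i; case: (unliftP ord_max i) => [j|] ->; last by rewrite mnmwiden_ordmax km.
transitivity (m j); first by rewrite -mk mnmE.
by rewrite lift_max_widen mnmwiden_widen.
Qed.

Lemma set_last0_widen p : set_last0 (mwiden p) = p.
Proof. by apply/mpolyP => m; rewrite mcoeff_set_last0 mwiden_mnmwiden. Qed.

Lemma set_last0_mesym k : set_last0 (mesym N.+1 R k) = mesym N R k.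
Proof.
case: k => [|k]; first by rewrite !mesym0E rmorph1.
by rewrite mesymSS rmorphD rmorphM /= set_last0Xmax mulr0 addr0 set_last0_widen.
Qed.

(* A monomial of degree at most N omits one of the N + 1 variables, and by
   symmetry that variable may be taken to be the last one. *)
Lemma symmetric_set_last0_eq0 d (g : {mpoly R[N.+1]}) : (d <= N)%N ->
  g \is symmetric -> g \is d.-homog -> set_last0 g = 0 -> g = 0.
Proof.
move=> dN gsym ghom g0; apply/mpolyP => m; rewrite mcoeff0.
have [md|] := eqVneq (mdeg m) d; last by apply: dhomog_nemf_coeff.
have [j /eqP mj] : exists j, m j == 0%N.
  apply/existsP; apply: contraLR dN; rewrite negb_exists => /forallP mpos.
  rewrite -ltnNge -md mdegE -[X in (X <= _)%N](card_ord N.+1) -sum1_card leq_sum // => j _.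
  by rewrite lt0n; apply: mpos.
rewrite -(msym_coeff m (tperm j ord_max) gsym).
have -> : [multinom m (tperm j ord_max i) | i < N.+1]
    = mnmwiden [multinom m (tperm j ord_max (lift ord_max i)) | i < N].
  apply/mnmP => i; case: (unliftP ord_max i) => [k|] ->.
    by rewrite mnmE [in RHS]lift_max_widen mnmwiden_widen mnmE.
  by rewrite mnmE tpermR mj mnmwiden_ordmax.
by rewrite -mcoeff_set_last0 g0 mcoeff0.
Qed.

End Restriction.

(** [mnmwgt] gives the variable of index [i] the weight [i.+1], the degree of the polynomial
    substituted for it. *)
Lemma comp_mesym_homog (R : comNzRingType) (k N d : nat) (p : {mpoly R[k]}) :
  p \is d.-homog for (@mnmwgt k) ->
  p \mPo [tuple mesym N R i.+1 | i < k] \is d.-homog.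
Proof.
move=> /dhomogP phom; rewrite comp_mpolyEX big_seq; apply: rpred_sum => m mp.
apply: rpredZ; rewrite comp_mpolyX.
pose dt := [tuple (i.+1 * m i)%N | i < k].
pose mt := [tuple mesym N R i.+1 ^+ m i | i < k].
rewrite (_ : \prod_(i < k) _ = \prod_(i <- mt) i); last first.
  by rewrite big_tuple; apply: eq_bigr => i _; rewrite !tnth_mktuple.
have <- : (\sum_(i <- dt) i)%N = d.
  rewrite -(phom _ mp) big_tuple; apply: eq_bigr => i _.
  by rewrite !tnth_mktuple mulnC.
apply: dhomog_prod => i; rewrite !tnth_mktuple.
exact/dhomogMn/dhomog_mesym.
Qed.

(** The fundamental theorem in [d] variables provides [p]. Fewer variables are reached by
    [set_last0]; for more, the difference of the two sides is symmetric, homogeneous of degree [d]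
    and killed by [set_last0], hence 0. *)
Lemma stable_symmetric_elementary (R : comNzRingType) (d : nat)
    (f : forall N, {mpoly R[N]}) :
    (forall N, f N \is symmetric) -> (forall N, f N \is d.-homog) ->
    (forall N, set_last0 (f N.+1) = f N) ->
  exists p : {mpoly R[d]}, forall N, f N = p \mPo [tuple mesym N R i.+1 | i < d].
Proof.
move=> fsym fhom fstable.
have [p [pE phom]] := sym_fundamental_homog (fsym d) (fhom d).
have gstable N : set_last0 (p \mPo [tuple mesym N.+1 R i.+1 | i < d])
    = p \mPo [tuple mesym N R i.+1 | i < d].
  rewrite /set_last0 comp_mpolyA; congr (p \mPo _).
  by apply/eq_from_tnth => i; rewrite !tnth_mktuple; apply: set_last0_mesym.
exists p => N; have [leNd|/ltnW ledN] := leqP N d.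
  rewrite -(subKn leNd); elim: (d - N)%N (leq_subr N d) => [|j IHj] jd.
    by rewrite subn0 pE.
  by have:= IHj (ltnW jd); rewrite -(subnSK jd) => /(congr1 (@set_last0 R _));
    rewrite fstable gstable.
rewrite -(subnKC ledN); elim: (N - d)%N => [|j IHj]; first by rewrite addn0 pE.
rewrite addnS; apply/eqP; rewrite -subr_eq0; apply/eqP.
apply: (@symmetric_set_last0_eq0 _ _ d); first exact: leq_addr.
- apply: rpredB; [exact: fsym | rewrite comp_mpolyEX]; apply: rpred_sum => m _.
  apply/rpredZ; rewrite comp_mpolyX; apply: rpred_prod => i _.
  by apply: rpredX; rewrite tnth_mktuple mesym_sym.
- by apply: rpredB; [exact: fhom | exact: comp_mesym_homog].
- by rewrite raddfB /= fstable gstable IHj subrr.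
Qed.

(** * Homogeneity and stability of the generating function of words *)

Lemma words_gf_homog n (E : rel 'I_n) N : words_gf E N \is n.-homog.
Proof.
apply: rpred_sum => T _; apply: rpredZ; rewrite mprodXE dhomogX /=.
by rewrite mdeg_sum (eq_bigr (fun _ => 1%N)) ?sum1_card ?card_ord // => a _; rewrite mdeg1.
Qed.

(** Words using the last letter vanish; on the others [lift ord_max] keeps the order of the letters,
    hence the inversions. *)
Lemma words_gf_stable n (E : rel 'I_n) N :
  set_last0 (words_gf E N.+1) = words_gf E N.
Proof.
pose h (T : {ffun 'I_n -> 'I_N}) : {ffun 'I_n -> 'I_N.+1} := [ffun a => lift ord_max (T a)].
have h_inj : injective h.
  by move=> T T' /ffunP TT'; apply/ffunP => a; have := TT' a; rewrite !ffunE => /lift_inj.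
rewrite /words_gf [LHS]rmorph_sum /= (bigID (fun T => T \in [set h T' | T' in setT])) /=.
rewrite [X in _ + X]big1 ?addr0 => [|T].
  rewrite big_imset /=; last by move=> ? ? _ _; apply: h_inj.
  rewrite (eq_bigl xpredT) => [|T]; last by rewrite inE.
  apply: eq_bigr => T _; rewrite [LHS]linearZ /=; congr (_ *: _).
    apply: eq_bigr => p _; rewrite !ffunE.
    by rewrite !lift_max.
  by rewrite rmorph_prod; apply: eq_bigr => a _; rewrite ffunE; apply: set_last0Xlift.
move=> TnI; rewrite [LHS]linearZ /= rmorph_prod.
have [/existsP[a /eqP Ta]|] := boolP [exists a, T a == ord_max].
  by rewrite (bigD1 a) //= Ta [X in X * _]set_last0Xmax mul0r scaler0.
rewrite negb_exists => /forallP Tmax; case/negP: TnI.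
have [T' TT'] : exists T' : 'I_n -> 'I_N, forall a, T a = lift ord_max (T' a).
  apply: (@fin_all_exists _ (fun _ => 'I_N) (fun a k => T a = lift ord_max k)) => a.
  by case: (unliftP ord_max (T a)) (Tmax a) => [k ->|->]; [exists k | rewrite eqxx].
by apply/imsetP; exists (finfun T'); rewrite ?inE //; apply/ffunP => a; rewrite !ffunE.
Qed.

(** * Elementary and complete symmetric polynomials *)

Section DualSequences.
Variable A : comPzRingType.
Implicit Types a b : nat -> A.

(* Up to degree k, the generating series of b is the inverse of that of a
   taken at -t, like the pair e, h of symmetric functions. *)
Definition dual_upto (k : nat) a b :=
  forall r : nat, (0 < r <= k)%N -> \sum_(i < r.+1) (-1) ^+ i * a i * b (r - i)%N = 0.

(** Reversing the order of summation only multiplies the sum by $(-1)^r$. *)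
Lemma dual_uptoC k a b : dual_upto k a b -> dual_upto k b a.
Proof.
move=> ab r rk; have := ab r rk; rewrite (reindex_inj rev_ord_inj) /=.
move=> /(congr1 ( *%R ((-1) ^+ r))); rewrite mulr0 mulr_sumr => {2}<-.
apply: eq_bigr => i _; have ir : (i <= r)%N by rewrite -ltnS.
rewrite subSS subKn //.
have -> : (-1) ^+ r = (-1) ^+ (r - i) * (-1) ^+ i :> A by rewrite -exprD subnK.
have : (-1) ^+ (r - i) * (-1) ^+ (r - i) = 1 :> A.
  by rewrite -expr2 -exprM mulnC exprM sqrrN expr1n expr1n.
move: ((-1) ^+ (r - i)) => s ss; rewrite -[LHS]mul1r -ss; ring.
Qed.

Lemma dual_upto_uniq k a b b' : a 0%N = 1 -> b 0%N = b' 0%N ->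
  dual_upto k a b -> dual_upto k a b' -> forall r, (r <= k)%N -> b r = b' r.
Proof.
move=> a0 b0 ab ab' r; have [m] := ubnP r; elim: m r => // m IHm [|r] rm rk //.
have := etrans (ab' r.+1 rk) (esym (ab r.+1 rk)).
rewrite [LHS]big_ord_recl [RHS]big_ord_recl /= !expr0 a0 !mul1r !subn0.
rewrite (eq_bigr (fun i : 'I_r.+1 => (-1) ^+ bump 0 i * a (bump 0 i) * b (r.+1 - bump 0 i)%N)).
  by move=> /addIr ->.
move=> i _; rewrite IHm //.
  by apply: leq_trans (_ : r.+1 <= m)%N; rewrite ?ltnS // subSS leq_subr.
by rewrite subSS (leq_trans (leq_subr _ _)) // ltnW.
Qed.

Lemma dual_upto_exists k a : exists2 b, b 0%N = 1 & (a 0%N = 1 -> dual_upto k a b).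
Proof.
elim: k => [|k [b b0 ab]]; first by exists (fun _ => 1) => // _ [|r].
(* The relation of degree [k.+1] reads [b k.+1 + s = 0], which dictates the new value [- s]. *)
pose s := \sum_(i < k.+1) (-1) ^+ i.+1 * a i.+1 * b (k - i)%N.
exists (fun r => if r == k.+1 then - s else b r) => // a0 r /andP[r0].
rewrite leq_eqVlt ltnS => /orP[/eqP->|rk].
  rewrite big_ord_recl expr0 a0 subn0 eqxx !mul1r addrC; apply/eqP; rewrite subr_eq0.
  apply/eqP; apply: eq_bigr => i _; rewrite /= subSS.
  by rewrite ltn_eqF // ltnS leq_subr.
rewrite -[RHS](ab a0 r); last by rewrite r0.
apply: eq_bigr => i _; rewrite ltn_eqF // ltnS.
exact: leq_trans (leq_subr _ _) rk.
Qed.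

End DualSequences.

Lemma dual_upto_morph (A B : comPzRingType) (f : {rmorphism A -> B}) k a b :
  dual_upto k a b -> dual_upto k (f \o a) (f \o b).
Proof.
move=> ab r rk; have /(congr1 f) := ab r rk; rewrite rmorph0 rmorph_sum => {2}<-.
by apply: eq_bigr => i _; rewrite !rmorphM rmorphXn rmorphN1.
Qed.

Lemma mcoeff_complete_sym r N m : (complete_sym r N)@_m = (mdeg m == r)%:R.
Proof.
rewrite /complete_sym raddf_sum /=.
have [mr|nmr] := eqVneq (mdeg m) r; last first.
  rewrite big1 // => k /eqP kr; rewrite mcoeffX; case: eqP => // km.
  by case/eqP: nmr; rewrite -km.
have mlt : (mdeg m < r.+1)%N by rewrite mr.
rewrite (bigD1 (BMultinom mlt)) /= ?mr // mcoeffX eqxx big1 ?addr0 // => k /andP[_ nk].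
rewrite mcoeffX; case: eqP => // km; case/eqP: nk; exact: val_inj.
Qed.

Lemma complete_sym0 N : complete_sym 0 N = 1.
Proof.
by apply/mpolyP => m; rewrite mcoeff_complete_sym mcoeff1 mdeg_eq0.
Qed.

(** A monomial either avoids the last variable or is divisible by it. *)
Lemma complete_symSS r N :
  complete_sym r.+1 N.+1
  = mwiden (complete_sym r.+1 N) + complete_sym r N.+1 * 'X_ord_max.
Proof.
apply/mpolyP => m; rewrite mcoeffD mcoeff_complete_sym.
case m0: (m ord_max) => [|u].
  have -> : m = mnmwiden [multinom m (lift ord_max i) | i < N].
    apply/mnmP => i; case: (unliftP ord_max i) => [k|] ->; last by rewrite mnmwiden_ordmax.
    by rewrite [in RHS]lift_max_widen mnmwiden_widen mnmE.
  set m' := [multinom _ | _ < _].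
  rewrite mwiden_mnmwiden mcoeff_complete_sym.
  rewrite -(mcoeff_set_last0 (_ * _)) rmorphM /= set_last0Xmax mulr0 mcoeff0 addr0.
  congr (_ == _)%:R; rewrite !mdegE big_ord_recr /= mnmwiden_ordmax addn0.
  by apply: eq_bigr => i _; rewrite mnmwiden_widen.
have -> : m = (U_(ord_max) + (m - U_(ord_max)))%MM.
  apply/mnmP => i; rewrite !mnmE; case: eqVneq => [<-|_]; first by rewrite m0 add1n subn1.
  by rewrite subn0.
rewrite mcoeffMX mcoeff_complete_sym mdegD mdeg1 add1n eqSS.
suff -> : (mwiden (complete_sym r.+1 N))@_(U_(ord_max) + (m - U_(ord_max))) = 0.
  by rewrite add0r.
rewrite (mwidenE (leqnn _)) raddf_sum /= big1 // => k _.
rewrite mcoeffZ mcoeffX; case: eqP => [/mnmP /(_ ord_max)|_]; last by rewrite mulr0.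
by rewrite mnmwiden_ordmax !mnmE eqxx.
Qed.

(** Induction on [N]: a new variable $x$ multiplies $E(-t)$ by $1-xt$ and divides $H(t)$ by it. *)
Lemma dual_elementary_complete k N :
  dual_upto k (fun r => elementary_sym r N) (fun r => complete_sym r N).
Proof.
move=> r /andP[r0 _]; rewrite /elementary_sym; elim: N r r0 => [|N IHN] [//|r] _.
  apply: big1 => i _; case: i => [[|i] ilt] /=.
    suff -> : complete_sym (r.+1 - 0) 0 = 0 by rewrite mulr0.
    apply/mpolyP => m; rewrite mcoeff_complete_sym mcoeff0 subn0.
    by rewrite mdegE big_ord0.
  by rewrite mesym_geqnE // mulr0 mul0r.
(* This is $(1-xt)H_{N+1}(t)=H_N(t)$ in degree [s]; the factor is then moved to the elementary
   side. *)
have wid s : complete_sym s N.+1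
    - (if s is s'.+1 then complete_sym s' N.+1 * 'X_ord_max else 0)
    = mwiden (complete_sym s N).
  case: s => [|s]; first by rewrite !complete_sym0 subr0 rmorph1.
  by rewrite complete_symSS addrK.
have /(congr1 (@mwiden _ _)) := IHN r.+1 isT; rewrite rmorph0 => {2}<-.
rewrite rmorph_sum /=.
under [RHS]eq_bigr => i _ do
  rewrite !rmorphM rmorphXn rmorphN1 /= -wid mulrBr.
rewrite sumrB [X in _ = _ - X]big_ord_recr /= subnn.
rewrite [X in _ = _ - X](etrans (congr1 _ (mulr0 _)) (addr0 _)).
rewrite [LHS]big_ord_recl [X in _ = X - _]big_ord_recl /= !mesym0E rmorph1 -addrA.
congr (_ + _).
rewrite -sumrB; apply: eq_bigr => i _; rewrite /= /bump !add1n.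
rewrite mesymSS subSS subSn ?leq_ord // exprS; ring.
Qed.


(** The variables stand for $e_1,\ldots,e_k$, and [w] lists $h_1,\ldots,h_k$ as polynomials in them.
    Duality is symmetric, so the same formulas give the $e_r$ from the $h_r$ and [w] is an
    involution. *)
Lemma omega_substitution k : exists w : k.-tuple {mpoly {poly int}[k]},
  (forall p, (p \mPo w) \mPo w = p) /\
  (forall N p, poly_in complete_sym p N = poly_in elementary_sym (p \mPo w) N).
Proof.
pose a r : {mpoly {poly int}[k]} :=
  if r is i.+1 then oapp (fun j : 'I_k => 'X_j) 0 (insub i) else 1.
have aX (i : 'I_k) : a i.+1 = 'X_i by rewrite /a valK.
have [b b0 /(_ erefl) ab] := dual_upto_exists k a.
pose w := [tuple b i.+1 | i < k].
have subst_a N (t : nat -> {mpoly {poly int}[N]}) r : t 0%N = 1 -> (r <= k)%N ->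
    a r \mPo [tuple t i.+1 | i < k] = t r.
  case: r => [|r] t0 rk; first by rewrite /= comp_mpoly1.
  by rewrite (aX (Ordinal rk)) comp_mpolyXU -tnth_nth tnth_mktuple.
(* By uniqueness of the dual sequence, [b] evaluated at any [t] yields its dual [u]. The pair [b],
   [a] gives the involution, the pair of elementary and complete polynomials the second claim. *)
have subst_b N (t u : nat -> {mpoly {poly int}[N]}) : t 0%N = 1 -> u 0%N = 1 ->
    dual_upto k t u ->
    forall r, (r <= k)%N -> b r \mPo [tuple t i.+1 | i < k] = u r.
  move=> t0 u0 tu r rk; pose f := comp_mpoly [tuple t i.+1 | i < k].
  apply: (@dual_upto_uniq _ k t (f \o b)) => //; first by rewrite /= /f b0 comp_mpoly1 u0.
  move=> s sk; rewrite -[RHS](dual_upto_morph f ab sk).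
  apply: eq_bigr => i _; congr (_ * _ * _); apply/esym/subst_a => //.
  by case/andP: sk => _; apply: leq_trans; rewrite -ltnS.
exists w; split=> [p|N p].
  rewrite comp_mpolyA -[RHS]comp_mpoly_id; congr (p \mPo _).
  apply/eq_from_tnth => i; rewrite !tnth_mktuple -aX.
  by apply: subst_b => //; apply: dual_uptoC.
rewrite /poly_in comp_mpolyA; congr (p \mPo _).
apply/eq_from_tnth => i; rewrite !tnth_mktuple.
rewrite (subst_b _ (fun r => elementary_sym r N) (fun r => complete_sym r N)) //.
- by rewrite /elementary_sym mesym0E.
- exact: complete_sym0.
- exact: dual_elementary_complete.
Qed.

(** Algebraic independence of the $h_r$, transported by [w] from that of $e_1,\ldots,e_k$ in [k]
    variables. *)
Lemma poly_in_complete_eq0 k (p : {mpoly {poly int}[k]}) :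
  (forall N, poly_in complete_sym p N = 0) -> p = 0.
Proof.
have [w [wK hE]] := omega_substitution k => /(_ k).
by rewrite hE => /msym_fundamental_un0 pw0; rewrite -(wK p) pw0 rmorph0.
Qed.

Lemma poly_in_widen k K (p : {mpoly {poly int}[k]}) : (k <= K)%N ->
  exists p' : {mpoly {poly int}[K]}, forall f N, poly_in f p' N = poly_in f p N.
Proof.
move=> kK; exists (p \mPo [tuple 'X_(widen_ord kK i) | i < k]) => f N.
rewrite /poly_in comp_mpolyA; congr (p \mPo _); apply/eq_from_tnth => i.
by rewrite !tnth_mktuple comp_mpolyXU -tnth_nth tnth_mktuple.
Qed.

(** * Unicellular LLT polynomials *)

(** Whichever polynomials witness the three specifications, independence of the $h_r$ turns the
    relation of series into one of polynomials, into which the $e_r$ can be substituted. *)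
Lemma omega_spec_linear_relation (c : {poly int}) (f0 f1 f2 g0 g1 g2 : series) :
    omega_spec f0 g0 -> omega_spec f1 g1 -> omega_spec f2 g2 ->
    (forall N, f0 N - f1 N = c *: (f1 N - f2 N)) ->
  forall N, g0 N - g1 N = c *: (g1 N - g2 N).
Proof.
move=> [k0 [p0 [f0E g0E]]] [k1 [p1 [f1E g1E]]] [k2 [p2 [f2E g2E]]] frel N.
have [P0 P0E] := poly_in_widen p0 (leq_addr (k1 + k2) k0).
have le1 : (k1 <= k0 + (k1 + k2))%N by lia.
have le2 : (k2 <= k0 + (k1 + k2))%N by lia.
have [P1 P1E] := poly_in_widen p1 le1.
have [P2 P2E] := poly_in_widen p2 le2.
have lin f M : poly_in f (P0 - P1 - c *: (P1 - P2)) M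
    = poly_in f p0 M - poly_in f p1 M - c *: (poly_in f p1 M - poly_in f p2 M).
  rewrite -P0E -P1E -P2E /poly_in.
  by rewrite comp_mpolyB comp_mpolyZ !comp_mpolyB.
have P_eq0 : P0 - P1 - c *: (P1 - P2) = 0.
  apply: poly_in_complete_eq0 => M; rewrite lin -f0E -f1E -f2E frel.
  exact: subrr.
apply/eqP; rewrite -subr_eq0 g0E g1E g2E -lin P_eq0; apply/eqP.
exact: comp_mpoly0.
Qed.

(** If $f=p(e)$, then [p \mPo w] evaluated at the $h_r$ is $f$ because [w] is an involution; so
    [epsilon] has a witness. *)
Lemma omega_spec_stable_symmetric (d : nat) (f : series) :
    (forall N, f N \is symmetric) -> (forall N, f N \is d.-homog) ->
    (forall N, set_last0 (f N.+1) = f N) ->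
  omega_spec f (omega f).
Proof.
move=> fsym fhom fstable.
have [p fE] := stable_symmetric_elementary fsym fhom fstable.
have [w [wK hE]] := omega_substitution d.
apply: epsilon_spec; exists (poly_in elementary_sym (p \mPo w)), d, (p \mPo w).
by split=> [N|N //]; rewrite hE wK fE.
Qed.

Definition part_nonincreasing (la : seq nat) : Prop :=
  forall j k, (1 <= j <= k)%N -> (part la k <= part la j)%N.

Lemma attack_lt n la (a b : 'I_n) : attack la a b -> (a < b)%N.
Proof. by case/andP. Qed.

(** The threshold [part la (n - b)] is nondecreasing in [b]. *)
Lemma attack_itv n la : part_nonincreasing la ->
  forall a b c : 'I_n, (a < b)%N -> (b < c)%N -> attack la a c ->
    attack la a b && attack la b c.
Proof.
move=> la_noninc a b c ab bc /andP[_ ac].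
have cb : (part la (n - b) <= part la (n - c))%N.
  by apply: la_noninc; have := ltn_ord c; lia.
by rewrite /attack; lia.
Qed.

Lemma omega_spec_LLT n la : part_nonincreasing la ->
  omega_spec (LLT n la) (L n la).
Proof.
move=> la_noninc; apply: (@omega_spec_stable_symmetric n) => N; rewrite !LLT_words.
- exact: words_gf_symmetric (@attack_lt _ _) (attack_itv la_noninc).
- exact: words_gf_homog.
- exact: words_gf_stable.
Qed.

Lemma part_add_to_part la i a j : (1 <= i)%N -> (1 <= j)%N ->
  part (add_to_part la i a) j = (part la j + (j == i) * a)%N.
Proof.
move=> i1 j1; rewrite /add_to_part /part; elim: a => [|a IHa]; first by rewrite muln0 addn0.
rewrite /= nth_incr_nth IHa.
have -> : (i.-1 == j.-1) = (j == i) by lia.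
by case: (j == i); lia.
Qed.

Lemma part_nonincreasing_partition la : is_partition la -> part_nonincreasing la.
Proof.
case/andP=> la_sorted _ j k /andP[j1 jk]; rewrite /part.
have [ks|sk] := ltnP k.-1 (size la); last by rewrite nth_default.
have geq_trans : transitive geq by move=> x y z /= xy yz; apply: leq_trans yz xy.
have geq_refl : reflexive geq by move=> x; apply: leqnn.
by apply: (sorted_leq_nth geq_trans geq_refl 0%N la_sorted); rewrite ?inE; lia.
Qed.

Lemma part_nonincreasing_add la i a : (1 <= i)%N -> part_nonincreasing la ->
    ((1 < i)%N -> (part la i + a <= part la (i - 1))%N) ->
  part_nonincreasing (add_to_part la i a).
Proof.
move=> i1 la_noninc la_i j k jk; rewrite !part_add_to_part; try lia.
have := la_noninc j k jk; have [kE|_] := eqVneq k i; last first.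
  by rewrite mul0n addn0 => /leq_trans; apply; apply: leq_addr.
rewrite mul1n; have [->|nji] := eqVneq j i; first by lia.
by have := la_noninc j (i - 1)%N; rewrite mul0n addn0 kE; lia.
Qed.

Unset Implicit Arguments.

Theorem theorem3p4 (n : nat) (la : seq nat) (i : nat) :
  (1 <= n)%N -> is_partition la -> (1 <= i)%N ->
  ((1 < i)%N -> (part la i + 2 <= part la (i - 1))%N) ->
  let mu := add_to_part la i in
  subpart (mu 2%N) (staircase (n - 1)) ->
  part la (n - part la i - 1) = part la (n - part la i) ->
  (forall N : nat,
     LLT n (mu 0%N) N - LLT n (mu 1%N) N
     = qvar *: (LLT n (mu 1%N) N - LLT n (mu 2%N) N)) /\
  (forall N : nat,
     L n (mu 0%N) N - L n (mu 1%N) N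
     = qvar *: (L n (mu 1%N) N - L n (mu 2%N) N)).
Proof.
move=> n1 la_part i1 la_i mu mu_delta la_twins.
have mu_noninc a : (a <= 2)%N -> part_nonincreasing (mu a).
  move=> a2; apply: part_nonincreasing_add => //; first exact: part_nonincreasing_partition.
  by move=> i2; have := la_i i2; lia.
have muE a j : (1 <= j)%N -> part (mu a) j = (part la j + (j == i) * a)%N.
  by move=> j1; rewrite part_add_to_part.
(* The staircase has [i]-th part $n-i$, or the default 0 beyond its length, which cannot bound
   $\lambda_i+2$. *)
have la_lt : (part la i + 2 + i <= n)%N.
  have := mu_delta i i1; rewrite muE // eqxx mul1n.
  have [si|is_] := ltnP i.-1 (size (staircase (n - 1)));
    last by rewrite {2}/part nth_default //; lia.
  rewrite {2}/part /staircase nth_rev; last by rewrite size_rev in si.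
  rewrite size_rev size_iota in si; rewrite size_iota nth_iota; lia.
have LLT_rel N : LLT n (mu 0%N) N - LLT n (mu 1%N) N
    = qvar *: (LLT n (mu 1%N) N - LLT n (mu 2%N) N).
  have an : (part la i < n)%N by lia.
  have a'n : ((part la i).+1 < n)%N by lia.
  have bn : (n - i < n)%N by lia.
  (* Only the threshold of [b] involves part [i]: the edges into [b] start at $\lambda_i+c$ for
     $\mu^c$, so the vertices [a] and [a'] are lost in turn. *)
  pose a := Ordinal an; pose a' := Ordinal a'n; pose b := Ordinal bn.
  have attackE c u v : @attack n (mu c) u v
      = (u < v)%N && (part la (n - v) + (v == b) * c < u.+1)%N.
    rewrite /attack muE; last by have := ltn_ord v; lia.
    congr (_ && (_ + _ * _ < _)%N); rewrite -val_eqE /=.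
    by have := ltn_ord v; lia.
  have ni : (n - (n - i) = i)%N by lia.
  have la_noninc := part_nonincreasing_partition la_part.
  have a'Nb : (a' == b) = false by rewrite -val_eqE /=; lia.
  have aNb : (a == b) = false by rewrite -val_eqE /=; lia.
  have a'E : (n - a' = n - part la i - 1)%N by rewrite /=; lia.
  have twins_le : (part la (n - part la i) <= part la i)%N.
    by apply: la_noninc; lia.
  (* [a] and [a'] could be told apart as left ends only by a threshold equal to $\lambda_i+1$. *)
  have gap (v : 'I_n) : v != b ->
      (part la (n - v) <= part la i)%N || (part la i + 2 <= part la (n - v))%N.
    rewrite -val_eqE /= => vb; have vn := ltn_ord v.
    have [iv|vi] := leqP i (n - v)%N; first by rewrite la_noninc // i1.
    have : (part la (i - 1) <= part la (n - v))%N by apply: la_noninc; lia.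
    by have := la_i; lia.
  rewrite !LLT_words; apply: (@words_gf_linear_relation _ _ _ _ a a' b).
  - exact: ltnSn.
  - by rewrite /=; lia.
  - by rewrite attackE eqxx /= ni; lia.
  - by rewrite attackE eqxx /= ni; lia.
  - by rewrite attackE a'Nb a'E la_twins /=; lia.
  - by rewrite attackE /= ltnNge leqnSn.
  - move=> u v; rewrite !attackE xpair_eqE -!val_eqE /=.
    by have [->|] := eqVneq (v : nat) (n - i)%N; rewrite ?ni; lia.
  - move=> u v; rewrite !attackE xpair_eqE -!val_eqE /=.
    by have [->|] := eqVneq (v : nat) (n - i)%N; rewrite ?ni; lia.
  (* As right ends, [a] and [a'] have equal thresholds by [la_twins]; as left ends, both miss [b] in
     $\mu^2$, and [gap] treats every other [v]. *)
  - move=> u v nuv nvu; rewrite !attackE; move: nuv nvu.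
    case: (tpermP a a' v) => [->|->|/eqP nva /eqP nva'];
      case: (tpermP a a' u) => [->|->|/eqP nua /eqP nua']; rewrite ?eqxx ?ltnn // => _ _;
      rewrite ?a'Nb ?aNb ?a'E ?la_twins.
    + by congr (_ && _); move: nua nua'; rewrite -!val_eqE /=; lia.
    + by congr (_ && _); move: nua nua'; rewrite -!val_eqE /=; lia.
    + have [vb|/gap] := eqVneq v b; first by rewrite vb /= ni; lia.
      by move: nva nva'; rewrite -!val_eqE /=; lia.
    + have [vb|/gap] := eqVneq v b; first by rewrite vb /= ni; lia.
      by move: nva nva'; rewrite -!val_eqE /=; lia.
split=> // N.
by apply: (@omega_spec_linear_relation _ (LLT n (mu 0%N)) (LLT n (mu 1%N)) (LLT n (mu 2%N)));
  try apply: omega_spec_LLT; try apply: mu_noninc.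
Qed.
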